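(* Let $(\mathbb{C}^n,T)$ be a Hilbert module. Then $$\operatorname{Ext}^1_{A(\mathbb{D})}(T,T)=0$$ if and only if $T$ is similar to a unitary.
   Context: $\mathbb{D}$ is the open unit disc in $\mathbb{C}$ and $A(\mathbb{D})$ is the disc algebra (functions holomorphic on $\mathbb{D}$ and continuous on $\overline{\mathbb{D}}$). A bounded linear operator $T$ on a Hilbert space $\mathcal{H}$ is polynomially bounded if there is a constant $C>0$ with $\|p(T)\|\le C\sup_{|z|<1}|p(z)|$ for every polynomial $p$; in that case $(\mathcal{H},T)$ (or simply $T$) is called a Hilbert module (over $A(\mathbb{D})$, via $f\cdot h=f(T)h$). For Hilbert modules $(\mathcal{H}_1,T_1)$ and $(\mathcal{H}_2,T_2)$, the extension group $\operatorname{Ext}^1_{A(\mathbb{D})}(T_2,T_1)$ is identified with the quotient $\mathcal{A}/\mathcal{J}$, where $\mathcal{A}$ is the space of bounded operators $X:\mathcal{H}_2\to\mathcal{H}_1$ for which $\begin{pmatrix}T_1&X\\0&T_2\end{pmatrix}$ on $\mathcal{H}_1\oplus\mathcal{H}_2$ is polynomially bounded, and $\mathcal{J}$ is the space of operators of the form $T_1L-LT_2$ with $L:\mathcal{H}_2\to\mathcal{H}_1$ bounded. *)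

(* Defs.v *)
From mathcomp Require Import all_boot all_order all_algebra.
From mathcomp Require Import spectral complex.
From mathcomp Require Import classical_sets reals.

Set Implicit Arguments.
Unset Strict Implicit.
Unset Printing Implicit Defensive.

Import Order.TTheory GRing.Theory Num.Theory.

Local Open Scope ring_scope.
Local Open Scope complex_scope.
Local Open Scope classical_set_scope.

(* Operators C^n -> C^m are the matrices 'M[R[i]]_(m, n), acting on column
   vectors; they are all bounded. *)
Section HilbertModules.
Variable R : realType.
Local Notation C := R[i].

(* The modulus with values in R: the generic `|z| of a numClosedFieldType lives
   in R[i]. *)
Definition cmod (z : C) : R := complex.Re `|z|.

Definition l2norm (n : nat) (x : 'cV[C]_n) : R :=
  Num.sqrt (\sum_(i < n) cmod (x i 0) ^+ 2).

Definition opnorm (m n : nat) (A : 'M[C]_(m, n)) : R :=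
  sup [set l2norm (A *m x) | x in [set x : 'cV[C]_n | l2norm x <= 1]].

(* sup_(|z| < 1) |p(z)|; the set is nonempty and bounded above for every p. *)
Definition disc_norm (p : {poly C}) : R :=
  sup [set cmod p.[z] | z in [set z : C | cmod z < 1]].

(* p(A); horner_mx is only available for sizes of the form n.+1, where it
   agrees with this sum (mxevalE). *)
Definition mxeval (n : nat) (A : 'M[C]_n) (p : {poly C}) : 'M[C]_n :=
  \sum_(i < size p) p`_i *: A ^+ i.

Lemma mxevalE (n : nat) (A : 'M[C]_n.+1) (p : {poly C}) :
  mxeval A p = horner_mx A p.
Proof.
rewrite -[in RHS](coefK p) poly_def rmorph_sum /=; apply: eq_bigr => i _.
by rewrite horner_mxZ rmorphXn /= horner_mx_X.
Qed.

Definition polynomially_bounded (n : nat) (A : 'M[C]_n) : Prop :=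
  exists2 K : R, 0 < K &
    forall p : {poly C}, opnorm (mxeval A p) <= K * disc_norm p.

Definition hilbert_module (n : nat) (T : 'M[C]_n) : Prop :=
  polynomially_bounded T.

Section Ext.
Variables (n2 n1 : nat) (T2 : 'M[C]_n2) (T1 : 'M[C]_n1).

Definition ext_space : set 'M[C]_(n1, n2) :=
  [set X | polynomially_bounded (block_mx T1 X 0 T2)].

Definition ext_trivial : set 'M[C]_(n1, n2) :=
  [set T1 *m L - L *m T2 | L in [set: 'M[C]_(n1, n2)]].

Definition ext_class (X : 'M[C]_(n1, n2)) : set 'M[C]_(n1, n2) :=
  [set X + Y | Y in ext_trivial].

(* The quotient of ext_space by ext_trivial, as its set of cosets; the zero
   element is ext_class 0. *)
Definition Ext1 : set (set 'M[C]_(n1, n2)) := ext_class @` ext_space.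

Definition Ext1_zero : Prop := Ext1 = [set ext_class 0].

End Ext.

Definition similar_to_unitary (n : nat) (T : 'M[C]_n) : Prop :=
  exists2 U : 'M[C]_n, U \is unitarymx & T ~_{in unitmx} U.

End HilbertModules.

(* Main.v *)
Require Import Defs.
From mathcomp Require Import all_boot all_order all_algebra.
From mathcomp Require Import spectral complex.
From mathcomp Require Import classical_sets reals.
From mathcomp Require Import cyclic separable cyclotomic.
From mathcomp Require Import ring lra.

(** Why the theorem holds.  A matrix is polynomially bounded exactly when its
eigenvalues lie in the closed disc and those on the circle are semisimple;
the two halves of this fact carry the proof.

- Power-boundedness forces it: an eigenvalue outside the closed disc makes
  the powers grow geometrically, and a Jordan chain over a unimodular
  eigenvalue makes them grow linearly ([pb_eigenvalue], [pb_semisimple]).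
  Hence the minimal polynomial of a polynomially bounded T is
  q = q_int * q_bd, where q_int has its roots in the open disc and q_bd has
  simple roots on the circle ([pb_mxminpoly_split]).

- Conversely, a matrix annihilated by such a product is polynomially bounded
  ([pb_of_annihilator]).  Newton interpolation at the roots writes p(A) as a
  fixed combination of iterated divided differences of p, and these are
  controlled by the supremum of |p| over the disc.

If T is similar to a unitary, one may take T = D diagonal with unimodular
entries.  Solving X = D L - L D entry by entry works except at the (i, j) with
d_i = d_j; the remaining part E of X commutes with D, so a nonzero column of E
would give a Jordan chain of the polynomially bounded matrix [D, E; 0, D].
Hence E = 0 ([diag_ext_trivial]).

If Ext vanishes, the cocycle X = q_bd(T) is tested.  It commutes with T, so
that f([T, X; 0, T]) = [f(T), f'(T) X; 0, f(T)], which is zero for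
f = q_int^2 * q_bd; thus X is an admissible cocycle.  If X = T L - L T, then
q'(T) X = q(T) L - L q(T) = 0, so q divides q' * q_bd.  The roots of q_int have
a smaller multiplicity in q' * q_bd than in q, so q_int is constant and
T is diagonalizable with unimodular eigenvalues ([ext_zero_minpoly]).
The rank one cocycle v w^T, with v and w right and left eigenvectors of T for an
interior eigenvalue, would be too small a test: over a nontrivial Jordan block
it is a commutator. *)

Set Implicit Arguments.
Unset Strict Implicit.
Unset Printing Implicit Defensive.

Import Order.TTheory GRing.Theory Num.Theory.

Local Open Scope ring_scope.
Local Open Scope complex_scope.

(** * The supremum over the disc controls boundary values and coefficients *)

Section Modulus.
Variable R : realType.
Local Notation C := R[i].
Implicit Types (z w : C) (p : {poly C}).

Lemma cmodE z : `|z| = (cmod z)%:C.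
Proof. by rewrite /cmod normc_def. Qed.

Lemma cmod_ge0 z : 0 <= cmod z.
Proof. by rewrite -lecR -cmodE normr_ge0. Qed.

Lemma cmod0 : cmod (0 : C) = 0.
Proof. by apply: (@complexI R); rewrite -cmodE normr0. Qed.

Lemma cmod1 : cmod (1 : C) = 1.
Proof. by apply: (@complexI R); rewrite -cmodE normr1. Qed.

Lemma cmodM z w : cmod (z * w) = cmod z * cmod w.
Proof. by apply: (@complexI R); rewrite rmorphM /= -!cmodE normrM. Qed.

Lemma cmodX z k : cmod (z ^+ k) = cmod z ^+ k.
Proof. by apply: (@complexI R); rewrite rmorphXn /= -!cmodE normrX. Qed.

Lemma cmodV z : cmod z^-1 = (cmod z)^-1.
Proof. by apply: (@complexI R); rewrite fmorphV /= -!cmodE normfV. Qed.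

Lemma cmodN z : cmod (- z) = cmod z.
Proof. by apply: (@complexI R); rewrite -!cmodE normrN. Qed.

Lemma cmodD z w : cmod (z + w) <= cmod z + cmod w.
Proof. by rewrite -lecR rmorphD /= -!cmodE ler_normD. Qed.

Lemma cmodB z w : cmod (z - w) <= cmod z + cmod w.
Proof. by rewrite -(cmodN w) cmodD. Qed.

Lemma cmod_sum (I : Type) (r : seq I) (P : pred I) (F : I -> C) :
  cmod (\sum_(i <- r | P i) F i) <= \sum_(i <- r | P i) cmod (F i).
Proof.
elim/big_rec2: _ => [|i y x _ le_yx]; first by rewrite cmod0.
by rewrite (le_trans (cmodD _ _))// lerD2l.
Qed.

Lemma cmod_eq0 z : (cmod z == 0) = (z == 0).
Proof. by rewrite -(inj_eq (@complexI R)) -cmodE normr_eq0. Qed.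

Lemma cmod_nat k : cmod (k%:R : C) = k%:R.
Proof. by apply: (@complexI R); rewrite -cmodE normr_nat rmorph_nat. Qed.

Lemma cmod_real (r : R) : 0 <= r -> cmod (r%:C) = r.
Proof. by move=> r0; apply: (@complexI R); rewrite -cmodE ger0_norm// lecR. Qed.

Lemma cmod_horner_le p z : cmod z <= 1 -> cmod p.[z] <= \sum_(i < size p) cmod p`_i.
Proof.
move=> z1; rewrite horner_coef (le_trans (cmod_sum _ _ _))// ler_sum// => i _.
by rewrite cmodM cmodX ler_piMr ?cmod_ge0// exprn_ile1 ?cmod_ge0.
Qed.

Lemma disc_norm_ub p z : cmod z < 1 -> cmod p.[z] <= disc_norm p.
Proof.
move=> z1; apply: ub_le_sup; last by exists z.
exists (\sum_(i < size p) cmod p`_i) => _ [w /ltW w1 <-].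
exact: cmod_horner_le.
Qed.

Lemma disc_norm_ge0 p : 0 <= disc_norm p.
Proof. by apply: le_trans (disc_norm_ub p (z := 0) _); rewrite ?cmod_ge0// cmod0. Qed.

Lemma disc_norm_le p (B : R) :
  (forall z, cmod z < 1 -> cmod p.[z] <= B) -> disc_norm p <= B.
Proof.
move=> pB; apply: ge_sup => [|_ [z z1 <-]]; last exact: pB.
by exists (cmod p.[0]), 0 => //=; rewrite cmod0.
Qed.

Lemma disc_norm_Xn k : disc_norm ('X^k : {poly C}) <= 1.
Proof.
by apply: disc_norm_le => z /ltW z1; rewrite hornerXn cmodX exprn_ile1 ?cmod_ge0.
Qed.

Lemma exprn_sub_bound (r : R) k : 0 <= r <= 1 -> 1 - r ^+ k <= k%:R * (1 - r).
Proof.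
move=> /andP[r0 r1]; elim: k => [|k IH]; first by rewrite expr0 subrr mul0r.
rewrite exprS -natr1; have : r ^+ k <= 1 by rewrite exprn_ile1.
nra.
Qed.

(** Continuity: p(z) is the limit of p(rz) as r increases to 1.  An explicit
Lipschitz constant K of p along the radius makes the limit elementary. *)
Lemma disc_norm_closed_ub p z : cmod z <= 1 -> cmod p.[z] <= disc_norm p.
Proof.
move=> z1; pose K := \sum_(i < size p) cmod p`_i * i%:R.
have K0 : 0 <= K by apply: sumr_ge0 => i _; rewrite mulr_ge0 ?cmod_ge0.
apply/ler_addgt0Pr => e e0.
(* the point (1 - s) z lies in the open disc and s is small enough that
   moving from z to it costs at most s * K <= e; the summand 1 + e in the
   denominator ensures 0 < s <= 1 *)
pose s := e / (K + 1 + e).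
have s0 : 0 < s by rewrite divr_gt0//; lra.
have s1 : s <= 1 by rewrite ler_pdivrMr; lra.
have Kse : s * K <= e.
  rewrite mulrAC ler_pdivrMr; last lra.
  by rewrite ler_wpM2l; lra.
have r01 : 0 <= 1 - s <= 1 by lra.
have rz1 : cmod ((1 - s)%:C * z) < 1.
  rewrite cmodM cmod_real; last lra.
  by have := cmod_ge0 z; nra.
rewrite -[p.[z]](subrK p.[(1 - s)%:C * z]).
rewrite (le_trans (cmodD _ _))// addrC lerD ?disc_norm_ub//.
apply: le_trans Kse; rewrite !horner_coef -sumrB.
rewrite (le_trans (cmod_sum _ _ _))// mulr_sumr ler_sum// => i _.
rewrite -mulrBr cmodM mulrCA ler_wpM2l ?cmod_ge0// exprMn -{1}[z ^+ i]mul1r.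
rewrite -mulrBl cmodM -rmorphXn /= -(rmorph1 (real_complex R)) -rmorphB.
rewrite cmod_real; last by rewrite subr_ge0 exprn_ile1//; lra.
apply: (@le_trans _ _ (1 - (1 - s) ^+ i)).
  rewrite ler_piMr ?subr_ge0 ?exprn_ile1//; try lra; last by rewrite cmodX exprn_ile1 ?cmod_ge0.
by rewrite mulrC (le_trans (exprn_sub_bound _ r01))//; lra.
Qed.

Lemma prim_root_exists N : (0 < N)%N -> exists z : C, N.-primitive_root z.
Proof.
pose p : {poly C} := 'X^N - 1; have [r Dp] := closed_field_poly_normal p.
move=> n_gt0; rewrite (monicP _) ?monicXnsubC // scale1r in Dp.
have rn1: all N.-unity_root r by apply/allP=> z; rewrite -root_prod_XsubC -Dp.
have sz_r: (N < (size r).+1)%N.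
  by rewrite -(size_prod_XsubC r id) -Dp size_XnsubC.
have [|z] := hasP (has_prim_root n_gt0 rn1 _ sz_r); last by exists z.
by rewrite -separable_prod_XsubC -Dp separable_Xn_sub_1 // pnatr_eq0 -lt0n.
Qed.

(** Discrete Cauchy estimate: with w a primitive N-th root of unity, N > deg p,
the coefficient p_k is the average of p(w^j) w^(-jk) over j < N. *)
Lemma coef_le_disc_norm p k : cmod p`_k <= disc_norm p.
Proof.
have [szp|kp] := leqP (size p) k; first by rewrite nth_default// cmod0 disc_norm_ge0.
have N0 : (0 < size p)%N by apply: leq_ltn_trans kp.
set N := size p in kp N0.
have [w wN] := prim_root_exists N0.
have w0 : w != 0 by rewrite (prim_root_eq0 wN) -lt0n.
have w1 : cmod w = 1.
  apply/eqP; rewrite -(@pexpr_eq1 _ (cmod w) N)// ?cmod_ge0//.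
  by rewrite -cmodX (prim_expr_order wN) cmod1.
have E : \sum_(j < N) p.[w ^+ j] * (w ^+ j) ^- k = N%:R * p`_k.
  under eq_bigr do rewrite horner_coef mulr_suml.
  rewrite exchange_big (bigD1 (Ordinal kp))//= [X in _ + X]big1 ?addr0 => [|m mk].
    under eq_bigr do rewrite mulfK ?expf_neq0//.
    by rewrite sumr_const card_ord mulr_natl.
  under eq_bigr do rewrite -mulrA -!exprM mulnC exprM [(_ * k)%N]mulnC (exprM w k) -exprVn -exprMn.
  rewrite -mulr_sumr.
  have u1 : w ^+ m / w ^+ k != 1.
    rewrite -subr_eq0 -[1](mulfV (expf_neq0 k w0)) -mulrBl mulf_neq0 ?invr_eq0 ?expf_neq0//.
    by rewrite subr_eq0 (eq_prim_root_expr wN) !modn_small//; apply: contraNN mk.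
  suff -> : \sum_(i < N) (w ^+ m / w ^+ k) ^+ i = 0 by rewrite mulr0.
  apply: (mulfI (_ : w ^+ m / w ^+ k - 1 != 0)); first by rewrite subr_eq0.
  rewrite mulr0 -subrX1 exprMn exprVn -!exprM ![(_ * N)%N]mulnC !exprM.
  by rewrite (prim_expr_order wN) !expr1n divr1 subrr.
have NR0 : (0 : R) < N%:R by rewrite ltr0n.
rewrite -(ler_pM2l NR0) -cmod_nat -cmodM -E cmod_nat.
rewrite (le_trans (cmod_sum _ _ _))//.
rewrite -[N in N%:R]card_ord mulr_natl -sumr_const ler_sum// => j _.
rewrite cmodM cmodV !cmodX w1 !expr1n invr1 mulr1 disc_norm_closed_ub//.
by rewrite cmodX w1 expr1n.
Qed.

End Modulus.

(** * Evaluation of polynomials at matrices *)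

Section PolynomialCalculus.
Variable R : realType.
Local Notation C := R[i].
Implicit Types (p q : {poly C}).

Lemma mxevalM n (A : 'M[C]_n) p q :
  mxeval A (p * q) = mxeval A p *m mxeval A q.
Proof.
case: n A => [|n] A; first by rewrite [LHS]flatmx0 [RHS]flatmx0.
by rewrite !mxevalE rmorphM.
Qed.

Lemma mxevalD n (A : 'M[C]_n) p q : mxeval A (p + q) = mxeval A p + mxeval A q.
Proof.
case: n A => [|n] A; first by rewrite [LHS]flatmx0 [RHS]flatmx0.
by rewrite !mxevalE rmorphD.
Qed.

Lemma mxevalC n (A : 'M[C]_n) (c : C) : mxeval A c%:P = c%:M.
Proof.
case: n A => [|n] A; first by rewrite [LHS]flatmx0 [RHS]flatmx0.
by rewrite !mxevalE horner_mx_C.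
Qed.

Lemma mxeval0 n (A : 'M[C]_n) : mxeval A 0 = 0.
Proof. by rewrite -polyC0 mxevalC raddf0. Qed.

Lemma mxevalX n (A : 'M[C]_n) : mxeval A 'X = A.
Proof.
case: n A => [|n] A; first by rewrite [LHS]flatmx0 [RHS]flatmx0.
by rewrite !mxevalE horner_mx_X.
Qed.

Lemma mxevalXsubC n (A : 'M[C]_n) (c : C) : mxeval A ('X - c%:P) = A - c%:M.
Proof. by rewrite -polyCN mxevalD mxevalX mxevalC raddfN. Qed.

Lemma mxevalXnS n (A : 'M[C]_n) k :
  mxeval A 'X^(k.+1) = A *m mxeval A 'X^k.
Proof. by rewrite exprS mxevalM mxevalX. Qed.

(** With S invertible this is invariance under similarity; rectangular S also
restricts A to an invariant subspace. *)
Lemma mxeval_intertwine m n (A : 'M[C]_m) (B : 'M[C]_n) (S : 'M[C]_(m, n)) p :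
  A *m S = S *m B -> mxeval A p *m S = S *m mxeval B p.
Proof.
move=> AS; elim/poly_ind: p => [|p c IH].
  by rewrite !mxeval0 mul0mx mulmx0.
rewrite !mxevalD !mxevalM !mxevalX !mxevalC mulmxDl mulmxDr -mulmxA AS.
by rewrite !mulmxA IH mul_scalar_mx mul_mx_scalar.
Qed.

(** This is p(T + eX) = p(T) + e p'(T) X with e^2 = 0, written in blocks;
commutation of X with T makes the first order term that simple. *)
Lemma mxeval_jordan_block n (T X : 'M[C]_n) p : T *m X = X *m T ->
  mxeval (block_mx T X 0 T) p =
    block_mx (mxeval T p) (mxeval T p^`() *m X) 0 (mxeval T p).
Proof.
move=> TX; elim/poly_ind: p => [|p c IH].
  by rewrite deriv0 !mxeval0 mul0mx block_mx0.
rewrite !mxevalD !mxevalM !mxevalX !mxevalC IH derivD derivM derivX derivC.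
rewrite addr0 mulr1 mxevalD mxevalM mxevalX mulmx_block !mul0mx !mulmx0 !addr0 add0r.
by rewrite scalar_mx_block add_block_mx !addr0 mulmxDl -!mulmxA TX [X in block_mx _ X]addrC.
Qed.

(** p |-> p(T) L - L p(T) is a derivation on polynomials; as its value X at the
variable commutes with T, it is p |-> p'(T) X. *)
Lemma mxeval_commutator n (T X L : 'M[C]_n) p :
  T *m X = X *m T -> X = T *m L - L *m T ->
  mxeval T p^`() *m X = mxeval T p *m L - L *m mxeval T p.
Proof.
move=> TX XE; elim/poly_ind: p => [|p c IH].
  by rewrite deriv0 !mxeval0 !mul0mx mulmx0 subrr.
rewrite !mxevalD !mxevalM !mxevalX !mxevalC derivD derivM derivX derivC.
rewrite addr0 mulr1 mxevalD mxevalM mxevalX mulmxDl -mulmxA TX mulmxA IH.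
rewrite {1}XE !mulmxDl !mulmxDr mulmxN mulNmx !mulmxA mul_scalar_mx mul_mx_scalar.
by rewrite opprD [RHS]addrACA subrr addr0 [LHS]addrC addrA subrK.
Qed.

End PolynomialCalculus.

(** * Polynomial boundedness through an entrywise norm *)

Section SumNorm.
Variable R : realType.
Local Notation C := R[i].

(** The operator norm is a supremum, awkward to compute with; this equivalent
norm is an explicit sum and is still submultiplicative. *)
Definition sumnorm m n (A : 'M[C]_(m, n)) : R := \sum_i \sum_j cmod (A i j).

Lemma sumnorm_ge0 m n (A : 'M[C]_(m, n)) : 0 <= sumnorm A.
Proof. by apply: sumr_ge0 => i _; apply: sumr_ge0 => j _; apply: cmod_ge0. Qed.

Lemma sumnorm0 m n : sumnorm (0 : 'M[C]_(m, n)) = 0.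
Proof. by rewrite /sumnorm big1// => i _; rewrite big1// => j _; rewrite mxE cmod0. Qed.

Lemma entry_le_sumnorm m n (A : 'M[C]_(m, n)) i j : cmod (A i j) <= sumnorm A.
Proof.
rewrite /sumnorm (bigD1 i)//= (bigD1 j)//= -addrA lerDl addr_ge0//.
  by apply: sumr_ge0 => *; apply: cmod_ge0.
by apply: sumr_ge0 => *; apply: sumr_ge0 => *; apply: cmod_ge0.
Qed.

Lemma sumnormD m n (A B : 'M[C]_(m, n)) : sumnorm (A + B) <= sumnorm A + sumnorm B.
Proof.
rewrite /sumnorm -big_split ler_sum//= => i _; rewrite -big_split ler_sum//= => j _.
by rewrite mxE cmodD.
Qed.

Lemma sumnormZ m n c (A : 'M[C]_(m, n)) : sumnorm (c *: A) = cmod c * sumnorm A.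
Proof.
rewrite /sumnorm mulr_sumr; apply: eq_bigr => i _; rewrite mulr_sumr.
by apply: eq_bigr => j _; rewrite mxE cmodM.
Qed.

Lemma sumnormM m n k (A : 'M[C]_(m, n)) (B : 'M[C]_(n, k)) :
  sumnorm (A *m B) <= sumnorm A * sumnorm B.
Proof.
apply: (@le_trans _ _ (\sum_i \sum_l cmod (A i l) * \sum_j cmod (B l j))).
  apply: ler_sum => i _.
  under [leRHS]eq_bigr do rewrite mulr_sumr.
  rewrite exchange_big ler_sum//= => j _; rewrite mxE (le_trans (cmod_sum _ _ _))//.
  by rewrite ler_sum// => l _; rewrite cmodM.
rewrite /sumnorm mulr_suml ler_sum// => i _; rewrite mulr_suml ler_sum// => l _.
rewrite ler_wpM2l ?cmod_ge0// [leRHS](bigD1 l)//= lerDl.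
by apply: sumr_ge0 => *; apply: sumr_ge0 => *; apply: cmod_ge0.
Qed.

Lemma l2norm_ge_entry n (x : 'cV[C]_n) i : cmod (x i 0) <= l2norm x.
Proof.
rewrite -[leLHS]ger0_norm ?cmod_ge0// -sqrtr_sqr ler_wsqrtr// (bigD1 i)//= lerDl.
by apply: sumr_ge0 => *; apply: sqr_ge0.
Qed.

Lemma sumnorm_col n (x : 'cV[C]_n) : sumnorm x = \sum_i cmod (x i 0).
Proof. by apply: eq_bigr => i _; rewrite big_ord1. Qed.

Lemma l2norm_le_sumnorm n (x : 'cV[C]_n) : l2norm x <= sumnorm x.
Proof.
rewrite sumnorm_col.
have [s0 le_s] : 0 <= \sum_i cmod (x i 0) /\
    \sum_(i < n) cmod (x i 0) ^+ 2 <= (\sum_i cmod (x i 0)) ^+ 2.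
  elim/big_rec2: _ => [|i y s _ [y0 sy]]; first by rewrite expr0n.
  have a0 := cmod_ge0 (x i 0); split; first exact: addr_ge0.
  by rewrite sqrrD; nra.
by rewrite -[leRHS]ger0_norm// -sqrtr_sqr ler_wsqrtr.
Qed.

Lemma l2norm_le1_sumnorm n (x : 'cV[C]_n) : l2norm x <= 1 -> sumnorm x <= n%:R.
Proof.
move=> x1; rewrite sumnorm_col -[n in n%:R]card_ord -sumr_const ler_sum// => i _.
exact: le_trans (l2norm_ge_entry _ _) x1.
Qed.

Lemma l2norm_mul_bound m n (A : 'M[C]_(m, n)) (x : 'cV[C]_n) :
  l2norm x <= 1 -> l2norm (A *m x) <= sumnorm A * n%:R.
Proof.
move=> x1; rewrite (le_trans (l2norm_le_sumnorm _))// (le_trans (sumnormM _ _))//.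
by rewrite ler_wpM2l ?sumnorm_ge0// l2norm_le1_sumnorm.
Qed.

Lemma opnorm_le_sumnorm m n (A : 'M[C]_(m, n)) : opnorm A <= sumnorm A * n%:R.
Proof.
apply: ge_sup => [|_ [x x1 <-]]; last exact: l2norm_mul_bound.
exists (l2norm (A *m 0)), 0 => //=.
rewrite (le_trans (l2norm_le_sumnorm _))// sumnorm0 //.
Qed.

Lemma entry_le_opnorm m n (A : 'M[C]_(m, n)) i j : cmod (A i j) <= opnorm A.
Proof.
apply: (@le_trans _ _ (l2norm (A *m delta_mx j 0))).
  apply: le_trans (l2norm_ge_entry _ i).
  by rewrite -colE mxE.
apply: ub_le_sup.
  by exists (sumnorm A * n%:R) => _ [x x1 <-]; apply: l2norm_mul_bound.
exists (delta_mx j 0) => //=; rewrite (le_trans (l2norm_le_sumnorm _))//.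
rewrite /sumnorm (bigD1 j)//= [X in _ + X]big1 => [|k kj];
  rewrite big_ord1 mxE ?eqxx ?cmod1 ?addr0//.
by rewrite (negPf kj) cmod0.
Qed.

Lemma pbP n (A : 'M[C]_n) : polynomially_bounded A <->
  exists K, forall p, sumnorm (mxeval A p) <= K * disc_norm p.
Proof.
split=> [[K _ AK]|[K AK]].
  exists ((n * n)%:R * K) => p; rewrite -mulrA.
  apply: (@le_trans _ _ ((n * n)%:R * opnorm (mxeval A p))); last first.
    by rewrite ler_wpM2l.
  rewrite natrM -mulrA /sumnorm -[n in n%:R * (_ * _)]card_ord mulr_natl -sumr_const.
  apply: ler_sum => i _; rewrite -[n in n%:R]card_ord mulr_natl -sumr_const.
  by apply: ler_sum => j _; apply: entry_le_opnorm.
exists (`|K| * n%:R + 1) => [|p]; first by rewrite ltr_wpDl// mulr_ge0.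
have d0 := disc_norm_ge0 p.
rewrite (le_trans (opnorm_le_sumnorm _))// mulrDl mul1r -[leLHS]addr0 lerD//.
by rewrite mulrAC ler_wpM2r// (le_trans (AK p))// ler_wpM2r// ler_norm.
Qed.

Lemma pb_similar n (A B S : 'M[C]_n) : S \in unitmx -> A *m S = S *m B ->
  polynomially_bounded A -> polynomially_bounded B.
Proof.
move=> Su AS /pbP[K AK]; apply/pbP.
exists (sumnorm (invmx S) * (K * sumnorm S)) => p.
rewrite -[mxeval B p](mulKmx Su) -(mxeval_intertwine _ AS).
rewrite (le_trans (sumnormM _ _))// -!mulrA ler_wpM2l ?sumnorm_ge0//.
rewrite (le_trans (sumnormM _ _))// [sumnorm S * _]mulrC mulrA.
by rewrite ler_wpM2r ?sumnorm_ge0.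
Qed.

Lemma pb_power_bounded n (A : 'M[C]_n) : polynomially_bounded A ->
  exists K, forall k, sumnorm (mxeval A 'X^k) <= K.
Proof.
move=> /pbP[K AK]; exists `|K| => k; rewrite (le_trans (AK _))//.
have := disc_norm_Xn R k; have := disc_norm_ge0 ('X^k : {poly C}).
by have := ler_norm K; have := normr_ge0 K; nra.
Qed.

End SumNorm.

(** * Divided differences and the sufficient condition *)

Section DividedDifference.
Variable R : realType.
Local Notation C := R[i].
Implicit Types (a b c : C) (p : {poly C}).

Definition divdiff a p : {poly C} := p %/ ('X - a%:P).

Lemma divdiff_eq a p : p = divdiff a p * ('X - a%:P) + p.[a]%:P.
Proof. by rewrite {1}(divp_eq p ('X - a%:P)) modp_XsubC. Qed.

Lemma horner_divdiff a b p : b != a ->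
  (divdiff a p).[b] = (p.[b] - p.[a]) / (b - a).
Proof.
move=> ba; apply: (mulIf (_ : b - a != 0)); first by rewrite subr_eq0.
by rewrite divfK ?subr_eq0// {2}(divdiff_eq a p) !hornerE addrK.
Qed.

Lemma coef_divdiff a p k :
  (divdiff a p)`_k = p`_k.+1 + a * (divdiff a p)`_k.+1.
Proof.
have /(congr1 (fun q : {poly C} => q`_k.+1)) := divdiff_eq a p.
rewrite mulrBr !coefE /= addr0 => ->.
by rewrite [X in - X]mulrC subrK.
Qed.

Lemma horner_as_coef_divdiff a p : p.[a] = p`_0 + a * (divdiff a p)`_0.
Proof.
have /(congr1 (fun q : {poly C} => q`_0)) := divdiff_eq a p.
rewrite mulrBr !coefE /= add0r => ->.
by rewrite mulrC addrAC addNr add0r.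
Qed.

(** By [coef_divdiff] the coefficients of (p - p(a)) / (X - a) are the series
p_(k+1) + a p_(k+2) + ..., dominated by a geometric one.  Bounding coefficients
rather than values near the node a replaces the maximum principle. *)
Lemma coef_divdiff_bound a p (B : R) : cmod a < 1 ->
  (forall k, cmod p`_k <= B) ->
  forall k, cmod (divdiff a p)`_k <= B / (1 - cmod a).
Proof.
move=> a1 pB k; have a0 := cmod_ge0 a; have B0 := le_trans (cmod_ge0 _) (pB 0).
have D0 : 0 <= B / (1 - cmod a) by rewrite divr_ge0//; lra.
(* downward induction on k, starting above the degree *)
have [m] := ubnP (size (divdiff a p) - k); elim: m k => // m IH k.
have [szk _|szk] := leqP (size (divdiff a p)) k.
  by rewrite nth_default// cmod0.
rewrite ltnS => szm; rewrite coef_divdiff (le_trans (cmodD _ _))//.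
have -> : B / (1 - cmod a) = B + cmod a * (B / (1 - cmod a)).
  by field; apply/eqP => E; move: a1; rewrite -subr_gt0 E ltxx.
rewrite lerD// cmodM ler_wpM2l//; apply: IH.
by rewrite (leq_trans _ szm)// ltn_sub2l.
Qed.

Lemma horner_coef_bound a p (B : R) : cmod a < 1 ->
  (forall k, cmod p`_k <= B) -> cmod p.[a] <= B / (1 - cmod a).
Proof.
move=> a1 pB; have a0 := cmod_ge0 a.
rewrite horner_as_coef_divdiff (le_trans (cmodD _ _))//.
have -> : B / (1 - cmod a) = B + cmod a * (B / (1 - cmod a)).
  by field; apply/eqP => E; move: a1; rewrite -subr_gt0 E ltxx.
by rewrite lerD// cmodM ler_wpM2l// coef_divdiff_bound.
Qed.

(** The Newton interpolation step: if q(A) (A - a) W = 0, then q(A) kills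
(A - a) W, so the node a has been removed from the annihilating product. *)
Lemma mxeval_divdiff m n (A : 'M[C]_n) (W : 'M[C]_(n, m)) a p :
  mxeval A p *m W =
    p.[a] *: W + mxeval A (divdiff a p) *m ((A - a%:M) *m W).
Proof.
rewrite {1}(divdiff_eq a p) mxevalD mxevalM mxevalXsubC mxevalC mulmxDl.
by rewrite mul_scalar_mx addrC mulmxA.
Qed.

(** The nodes being distinct, the values of a divided difference at the other
nodes are quotients of values of p by fixed nonzero distances. *)
Lemma boundary_annihilator_bound m n (A : 'M[C]_n) (W : 'M[C]_(n, m)) (s : seq C) :
  uniq s -> mxeval A (\prod_(b <- s) ('X - b%:P)) *m W = 0 ->
  exists K, forall p (B : R), (forall b, b \in s -> cmod p.[b] <= B) ->
    sumnorm (mxeval A p *m W) <= K * B.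
Proof.
elim: s W => [|b s IH] W /=.
  rewrite big_nil -polyC1 mxevalC mul1mx => _ ->; exists 0 => p B _.
  by rewrite mulmx0 sumnorm0 mul0r.
move=> /andP[bs us]; rewrite big_cons mulrC mxevalM -mulmxA mxevalXsubC.
move=> /(IH _ us)[K HK].
pose c := \big[Order.max/0]_(b' <- s) (2 / cmod (b' - b)).
exists (sumnorm W + K * c) => p B pB.
have pb : cmod p.[b] <= B by apply: pB; rewrite mem_head.
have B0 := le_trans (cmod_ge0 _) pb.
rewrite (mxeval_divdiff _ _ b) (le_trans (sumnormD _ _))// mulrDl lerD//.
  by rewrite sumnormZ mulrC ler_wpM2l ?sumnorm_ge0.
rewrite -mulrA HK// => b' b's.
have b'b : b' != b by apply: contraNneq bs => <-.
rewrite horner_divdiff// cmodM cmodV.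
apply: (@le_trans _ _ (2 / cmod (b' - b) * B)).
  rewrite mulrAC ler_wpM2r ?invr_ge0 ?cmod_ge0// (le_trans (cmodB _ _))//.
  by rewrite mulrDl mul1r lerD// pB// inE b's orbT.
by rewrite ler_wpM2r// /c; apply: le_bigmax_seq b's _.
Qed.

(** The interior nodes, possibly repeated, are removed first: dividing by X - a
with |a| < 1 preserves bounds both on the coefficients and on the values at
the circle, whereas dividing by X - b with |b| = 1 would lose the former. *)
Lemma annihilator_bound m n (A : 'M[C]_n) (W : 'M[C]_(n, m)) (s t : seq C) :
  {in s, forall a, cmod a < 1} -> uniq t -> {in t, forall b, cmod b = 1} ->
  mxeval A (\prod_(a <- s) ('X - a%:P) * \prod_(b <- t) ('X - b%:P)) *m W = 0 ->
  exists K, forall p (B : R), (forall k, cmod p`_k <= B) ->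
    (forall b, b \in t -> cmod p.[b] <= B) ->
    sumnorm (mxeval A p *m W) <= K * B.
Proof.
move=> + ut t1; elim: s W => [|a s IH] W s1.
  rewrite big_nil mul1r => /(boundary_annihilator_bound ut)[K HK].
  by exists K => p B _; apply: HK.
rewrite big_cons -mulrA mulrC mxevalM -mulmxA mxevalXsubC.
have a1 : cmod a < 1 by apply: s1; rewrite mem_head.
case/IH => [a' a's|K HK]; first by apply: s1; rewrite inE a's orbT.
pose d := 1 - cmod a; have d0 : 0 < d by rewrite subr_gt0.
have dle1 : d <= 1 by have := cmod_ge0 a; rewrite /d; lra.
(* |p(b) - p(a)| <= 2 B / d and |b - a| >= d, hence the factor 2 / d^2 *)
pose c := 2 / d ^+ 2.
exists (sumnorm W / d + K * c) => p B pB tB.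
have B0 := le_trans (cmod_ge0 _) (pB 0).
rewrite (mxeval_divdiff _ _ a) (le_trans (sumnormD _ _))// mulrDl lerD//.
  by rewrite sumnormZ mulrC -mulrA ler_wpM2l ?sumnorm_ge0// mulrC horner_coef_bound.
have dB : B / d <= c * B.
  rewrite /c ler_pdivrMr//.
  have -> : 2 / d ^+ 2 * B * d = 2 * B / d by field; rewrite gt_eqF.
  by rewrite ler_pdivlMr//; nra.
rewrite -mulrA; apply: HK => [k|b bt].
  exact: le_trans (coef_divdiff_bound a1 pB k) dB.
have bad : d <= cmod (b - a).
  by rewrite /d -(t1 b bt) lerBlDr -{1}[b](subrK a) cmodD.
have ba : b != a by rewrite -subr_eq0 -cmod_eq0 gt_eqF// (lt_le_trans d0).
rewrite horner_divdiff// cmodM cmodV ler_pdivrMr; last exact: lt_le_trans bad.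
apply: (@le_trans _ _ (c * B * d)); last first.
  by rewrite ler_wpM2l// mulr_ge0// divr_ge0// exprn_ge0// ltW.
have -> : c * B * d = B / d + B / d by rewrite /c; field; rewrite gt_eqF.
rewrite (le_trans (cmodB _ _))// lerD ?horner_coef_bound//.
rewrite (le_trans (tB b bt))// ler_pdivlMr// ler_piMr//.
Qed.

Lemma pb_of_annihilator n (A : 'M[C]_n) (s t : seq C) :
  {in s, forall a, cmod a < 1} -> uniq t -> {in t, forall b, cmod b = 1} ->
  mxeval A (\prod_(a <- s) ('X - a%:P) * \prod_(b <- t) ('X - b%:P)) = 0 ->
  polynomially_bounded A.
Proof.
move=> s1 ut t1 A0.
have [|K HK] := @annihilator_bound _ _ A 1%:M s t s1 ut t1; first by rewrite A0 mul0mx.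
apply/pbP; exists K => p; rewrite -[mxeval A p]mulmx1.
apply: HK => [k|b /t1 b1]; first exact: coef_le_disc_norm.
by rewrite disc_norm_closed_ub// b1.
Qed.

End DividedDifference.

(** * Growth of powers and the necessary condition *)

Section Growth.
Variable R : realType.
Local Notation C := R[i].

Lemma mulrn_bounded_le0 (x B : R) : (forall k : nat, k%:R * x <= B) -> x <= 0.
Proof.
move=> xB; rewrite leNgt; apply/negP => x0.
have Bx0 : 0 <= `|B| / x by rewrite divr_ge0// ltW.
have := archi_boundP Bx0; rewrite ltr_pdivrMr//.
by have := xB (Num.bound (`|B| / x)); have := ler_norm B; lra.
Qed.

Lemma bernoulli_ge (h : R) k : 0 <= h -> k%:R * h <= (1 + h) ^+ k.
Proof.
move=> h0; suff : 1 + k%:R * h <= (1 + h) ^+ k by lra.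
elim: k => [|k IH]; first by rewrite mul0r addr0.
rewrite exprS -natr1; have k0 : (0 : R) <= k%:R by []; nra.
Qed.

Lemma geometric_bounded (l w : C) (B : R) : w != 0 ->
  (forall k, cmod (l ^+ k * w) <= B) -> cmod l <= 1.
Proof.
move=> w0 lB; rewrite leNgt; apply/negP => l1.
have wp : 0 < cmod w by rewrite lt_def cmod_eq0 w0 cmod_ge0.
suff : (cmod l - 1) * cmod w <= 0 by nra.
apply: (@mulrn_bounded_le0 _ B) => k; apply: le_trans (lB k).
rewrite cmodM cmodX mulrA ler_wpM2r ?cmod_ge0//.
by rewrite -{2}(subrKC 1 (cmod l)) bernoulli_ge// subr_ge0 ltW.
Qed.

Lemma jordan_growth_bounded (l u v : C) (B : R) : cmod l = 1 ->
  (forall k : nat, cmod (l ^+ k * (u + k%:R * v)) <= B) -> v = 0.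
Proof.
move=> l1 lB; apply/eqP; rewrite -cmod_eq0; apply/eqP/le_anti.
rewrite cmod_ge0 andbT; apply: (@mulrn_bounded_le0 _ (B + cmod u)) => k.
rewrite -cmod_nat -cmodM -[_ * v](addKr u) addrC (le_trans (cmodB _ _))//.
by rewrite lerD2r; have := lB k; rewrite cmodM cmodX l1 expr1n mul1r.
Qed.

Lemma pb_eigenvalue n m (A : 'M[C]_n) (W : 'M[C]_(n, m)) l :
  polynomially_bounded A -> A *m W = l *: W -> W != 0 -> cmod l <= 1.
Proof.
move=> /pb_power_bounded[K AK] AW W0.
have [[i j] Wij] : exists ij : 'I_n * 'I_m, W ij.1 ij.2 != 0.
  apply/existsP; apply: contraNT W0; rewrite negb_exists => /forallP W0.
  by apply/eqP/matrixP => i j; rewrite mxE; apply/eqP; have := W0 (i, j); rewrite negbK.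
apply: (@geometric_bounded _ _ (K * sumnorm W) Wij) => k.
have -> : l ^+ k * W i j = (mxeval A 'X^k *m W) i j.
  suff -> : mxeval A 'X^k *m W = l ^+ k *: W by rewrite mxE.
  elim: k => [|k IH]; first by rewrite expr0 -polyC1 mxevalC mul1mx scale1r.
  by rewrite mxevalXnS -mulmxA IH -scalemxAr AW scalerA -exprSr.
rewrite (le_trans (entry_le_sumnorm _ _ _))// (le_trans (sumnormM _ _))//.
by rewrite ler_wpM2r// sumnorm_ge0.
Qed.

(** The columns of W and V form Jordan chains of length two, along which
A^k W = l^k W + k l^(k-1) V. *)
Lemma pb_semisimple n m (A : 'M[C]_n) (W V : 'M[C]_(n, m)) l :
  polynomially_bounded A -> cmod l = 1 ->
  A *m W = l *: W + V -> A *m V = l *: V -> V = 0.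
Proof.
move=> /pb_power_bounded[K AK] l1 AW AV; apply/matrixP => i j; rewrite [RHS]mxE.
apply: (@jordan_growth_bounded l (l * W i j) _ (K * sumnorm W)) => // k.
have -> : l ^+ k * (l * W i j + k%:R * V i j) = (l *: (mxeval A 'X^k *m W)) i j.
  (* the extra factor l turns l^(k-1) into l^k, avoiding a predecessor *)
  have -> : l *: (mxeval A 'X^k *m W) = l ^+ k *: (l *: W + k%:R *: V).
    elim: k => [|k IH].
      by rewrite expr0 -polyC1 mxevalC mul1mx scale1r scale0r addr0.
    rewrite mxevalXnS -mulmxA scalemxAr IH -scalemxAr mulmxDr -!scalemxAr AW AV.
    by apply/matrixP => a b; rewrite !mxE exprS -natr1; ring.
  by rewrite !mxE.
rewrite mxE cmodM l1 mul1r.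
rewrite (le_trans (entry_le_sumnorm _ _ _))// (le_trans (sumnormM _ _))//.
by rewrite ler_wpM2r// sumnorm_ge0.
Qed.

End Growth.

(** * Extensions of a module by itself *)

Section Extensions.
Variable R : realType.
Local Notation C := R[i].

(** The direct sum is an extension, so the zero class does belong to Ext and
only the inclusion of the cocycles in the commutators matters. *)
Lemma Ext1_zeroP n (T : 'M[C]_n) : polynomially_bounded T ->
  Ext1_zero T T <-> (forall X : 'M[C]_n, polynomially_bounded (block_mx T X 0 T) ->
    exists L, X = T *m L - L *m T).
Proof.
move=> Tpb; have ext0 : ext_space T T 0.
  have /pbP[K TK] := Tpb; apply/pbP; exists (K + K) => p.
  rewrite mxeval_jordan_block ?mulmx0 ?mul0mx//.
  have -> : sumnorm (block_mx (mxeval T p) 0 0 (mxeval T p)) =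
            sumnorm (mxeval T p) + sumnorm (mxeval T p).
    rewrite /sumnorm big_split_ord /=; congr (_ + _); apply: eq_bigr => i _;
      rewrite big_split_ord /=.
      under eq_bigr do rewrite block_mxEul.
      rewrite [X in _ + X]big1 ?addr0// => j _.
      by rewrite block_mxEur mxE cmod0.
    under [X in _ + X]eq_bigr do rewrite block_mxEdr.
    rewrite big1 ?add0r// => j _.
    by rewrite block_mxEdl mxE cmod0.
  by rewrite mulrDl lerD.
split=> [E X Xpb|ETL].
  have : Ext1 T T (ext_class T T X) by exists X.
  rewrite E /= => EX.
  have : ext_class T T X X.
    by exists 0; rewrite ?addr0//; exists 0 => //; rewrite mulmx0 mul0mx subrr.
  by rewrite EX => -[_ [L _ <-] <-]; exists L; rewrite add0r.
apply/seteqP; split=> [_ [X /ETL[L XL] <-]|_ ->]; last by exists 0.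
apply/seteqP; split=> _ [_ [L' _ <-] <-].
  exists (T *m (L + L') - (L + L') *m T); first by exists (L + L').
  by rewrite add0r XL mulmxDr mulmxDl opprD addrACA.
exists (T *m (L' - L) - (L' - L) *m T); first by exists (L' - L).
rewrite add0r XL mulmxBr mulmxBl.
by apply/matrixP => i j; rewrite !mxE; ring.
Qed.

(** X is cohomologous to its part E that commutes with D; a nonzero column j of E
would be the end of a Jordan chain over d_j starting at the j-th basis vector
of the second summand. *)
Lemma diag_ext_trivial n (d : 'rV[C]_n) (X : 'M[C]_n) :
  (forall i, cmod (d 0 i) = 1) ->
  polynomially_bounded (block_mx (diag_mx d) X 0 (diag_mx d)) ->
  exists L, X = diag_mx d *m L - L *m diag_mx d.
Proof.
move=> d1 Xpb.
(* division by zero gives L i j = 0 where d_i = d_j *)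
pose L : 'M[C]_n := \matrix_(i, j) (X i j / (d 0 i - d 0 j)).
pose E := X - (diag_mx d *m L - L *m diag_mx d).
have EE i j : E i j = if d 0 i == d 0 j then X i j else 0.
  rewrite /E mul_diag_mx mul_mx_diag !mxE.
  have [->|dij] := eqVneq (d 0 i) (d 0 j).
    by rewrite subrr invr0 !mulr0 mul0r subrr subr0.
  by field; rewrite subr_eq0.
have DE : diag_mx d *m E = E *m diag_mx d.
  rewrite mul_diag_mx mul_mx_diag; apply/matrixP => i j; rewrite [LHS]mxE [RHS]mxE EE mulrC.
  by case: eqP => [->|]; rewrite ?mul0r.
have Epb : polynomially_bounded (block_mx (diag_mx d) E 0 (diag_mx d)).
  apply: (pb_similar (S := block_mx 1%:M (- L) 0 1%:M)) Xpb.
    by rewrite unitmxE det_ublock !det1 mulr1 unitr1.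
  rewrite !mulmx_block !mul0mx !mulmx0 !mulmx1 !mul1mx !addr0 !add0r mulmxN mulNmx.
  congr block_mx.
  by rewrite /E; apply/matrixP => i j; rewrite !mxE; ring.
exists L; apply/eqP; rewrite -subr_eq0 -/E; apply/eqP/matrixP => i j.
pose W : 'cV[C]_(n + n) := col_mx 0 (delta_mx j 0).
pose V : 'cV[C]_(n + n) := col_mx (E *m delta_mx j 0) 0.
have dj : diag_mx d *m (delta_mx j 0 : 'cV[C]_n) = d 0 j *: delta_mx j 0.
  apply/matrixP => a b; rewrite mul_diag_mx !mxE.
  by case: eqP => [->//|]; rewrite !mulr0.
have : V = 0.
  apply: (@pb_semisimple _ _ _ _ W V (d 0 j) Epb) => //.
    rewrite mul_block_col !mulmx0 !add0r dj.
    by rewrite scale_col_mx scaler0 add_col_mx add0r addr0.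
  by rewrite mul_block_col !mulmx0 mul0mx !addr0 mulmxA DE -mulmxA dj
    -scalemxAr scale_col_mx scaler0.
rewrite -col_mx0 => /eq_col_mx[+ _] => /matrixP/(_ i 0).
by rewrite -colE !mxE.
Qed.

Lemma diag_unitaryP n (d : 'rV[C]_n) :
  diag_mx d \is unitarymx <-> forall i, cmod (d 0 i) = 1.
Proof.
have dd i : (d 0 i * (d 0 i)^*%R == 1) = (cmod (d 0 i) == 1).
  rewrite -normCK -[1 in LHS](expr1n _ 2) eqrXn2 ?normr_ge0//.
  by rewrite cmodE -(inj_eq (@complexI R)) rmorph1.
rewrite -(rwP unitarymxP) tr_diag_mx map_diag_mx mulmx_diag.
split=> [/matrixP dU i|d1].
  by have := dU i i; rewrite !mxE eqxx !mulr1n => /eqP; rewrite dd => /eqP.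
apply/matrixP => i j; rewrite !mxE; congr (_ *+ _); apply/eqP.
by rewrite dd d1.
Qed.

Lemma similar_to_unitary_diag n (T : 'M[C]_n) : similar_to_unitary T ->
  exists P d, [/\ P \in unitmx, P *m T = diag_mx d *m P & forall i, cmod (d 0 i) = 1].
Proof.
move=> [U Uu [Q Qu /(mxpoly.simmxP Qu) QT]].
have Un : U \is normalmx.
  apply/normalmxP; rewrite (unitarymxP Uu) -(invmx_unitary Uu).
  by rewrite mulVmx// unitarymx_unit.
have [P [d [Pu UE]]] : exists P d, P \is unitarymx /\ U = invmx P *m diag_mx d *m P.
  exists (spectralmx U), (spectral_diag U); split; first exact: spectral_unitarymx.
  exact/orthomx_spectralP.
have Pi := unitarymx_unit Pu.
have PU : P *m U = diag_mx d *m P by rewrite UE -mulmxA (mulKVmx Pi).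
exists (P *m Q), d; split; first by rewrite unitmx_mul Pi.
  by rewrite -mulmxA QT !mulmxA PU.
apply/diag_unitaryP; rewrite -(mulmxK Pi (diag_mx d)) -PU.
apply: (mul_unitarymx (mul_unitarymx Pu Uu)).
by rewrite (invmx_unitary Pu) trmxC_unitary.
Qed.

Lemma unitary_ext_zero n (T X : 'M[C]_n) : similar_to_unitary T ->
  polynomially_bounded (block_mx T X 0 T) -> exists L, X = T *m L - L *m T.
Proof.
move=> /similar_to_unitary_diag[P [d [Pu PT d1]]] Xpb.
have TE : T = invmx P *m diag_mx d *m P by rewrite -mulmxA -PT mulKmx.
have /(diag_ext_trivial d1)[L XL] :
    polynomially_bounded (block_mx (diag_mx d) (P *m X *m invmx P) 0 (diag_mx d)).
  apply: (pb_similar (S := block_mx (invmx P) 0 0 (invmx P))) Xpb.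
    by rewrite unitmxE det_ublock unitrM -unitmxE unitmx_inv Pu.
  rewrite !mulmx_block !mul0mx !mulmx0 !addr0 !add0r TE !mulmxA mulmxK//.
  by rewrite mulVmx// mul1mx.
exists (invmx P *m L *m P).
have -> : X = invmx P *m (P *m X *m invmx P) *m P.
  by rewrite !mulmxA mulVmx// mul1mx mulmxKV.
rewrite XL mulmxBr mulmxBl TE !mulmxA.
by rewrite !(mulmxK Pu) // -!mulmxA.
Qed.

Lemma uniq_rem (I : eqType) (s : seq I) :
  (forall x, x \in s -> x \notin rem x s) -> uniq s.
Proof.
elim: s => //= x s IH xs; have := xs x; rewrite mem_head eqxx => /(_ isT) xNs.
rewrite xNs IH// => y ys; have := xs y; rewrite inE ys orbT => /(_ isT).
by case: eqP => [E|_]; [rewrite E ys in xNs | rewrite inE negb_or => /andP[]].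
Qed.

(** Minimality: the cofactor has smaller degree. *)
Lemma mxminpoly_factor_neq0 n (T : 'M[C]_n.+1) a (g : {poly C}) :
  mxminpoly T = ('X - a%:P) * g -> mxeval T g != 0.
Proof.
move=> qE; rewrite mxevalE; apply/eqP => /mxminpoly_min.
have g0 : g != 0.
  by apply/eqP => g0; have := monic_neq0 (mxminpoly_monic T); rewrite qE g0 mulr0 eqxx.
by move=> /dvdp_leq => /(_ g0); rewrite qE size_mul ?polyXsubC_eq0// size_XsubC /= ltnn.
Qed.

(** The cofactor g of a root a, evaluated at T, is a nonzero matrix of
eigenvectors for a; for a double root b, the columns of (q / (X - b)^2)(T) start
Jordan chains over b, not all of them trivial. *)
Lemma pb_mxminpoly_split n (T : 'M[C]_n.+1) : polynomially_bounded T ->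
  exists s t : seq C, [/\ {in s, forall a, cmod a < 1}, {in t, forall b, cmod b = 1},
    uniq t & mxminpoly T = \prod_(a <- s) ('X - a%:P) * \prod_(b <- t) ('X - b%:P)].
Proof.
move=> Tpb; have [r] := closed_field_poly_normal (mxminpoly T).
rewrite (monicP (mxminpoly_monic T)) scale1r => qr.
have q0 : mxeval T (mxminpoly T) = 0 by rewrite mxevalE mx_root_minpoly.
have r1 a : a \in r -> cmod a <= 1.
  move=> ar; move: qr; rewrite (big_rem _ ar) /= => qE.
  apply: (pb_eigenvalue Tpb (W := mxeval T (\prod_(y <- rem a r) ('X - y%:P)))).
    apply/eqP; rewrite -mul_scalar_mx -subr_eq0 -mulmxBl -mxevalXsubC -mxevalM.
    by rewrite -qE q0.
  exact: mxminpoly_factor_neq0 qE.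
pose s := [seq a <- r | cmod a != 1]; pose t := [seq a <- r | cmod a == 1].
have qE : mxminpoly T = \prod_(a <- s) ('X - a%:P) * \prod_(b <- t) ('X - b%:P).
  rewrite qr -big_cat /=; apply: perm_big; rewrite perm_sym perm_catC.
  exact: permEl (perm_filterC (fun a => cmod a == 1) r).
have t1 : {in t, forall b, cmod b = 1} by move=> b; rewrite mem_filter => /andP[/eqP].
exists s, t; split=> // [a|].
  by rewrite mem_filter lt_def eq_sym => /andP[-> /r1].
apply: uniq_rem => b bt; apply/negP => btt.
have qE2 : mxminpoly T = ('X - b%:P) *
    (('X - b%:P) * (\prod_(c <- rem b (rem b t)) ('X - c%:P) *
      \prod_(a <- s) ('X - a%:P))).
  by rewrite qE (big_rem _ bt) /= (big_rem _ btt) /=; ring.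
have /eqP := mxminpoly_factor_neq0 qE2; apply.
set h := (_ * \prod_(a <- s) _) in qE2 *; clearbody h.
have Vb : (T - b%:M) *m mxeval T (('X - b%:P) * h) = 0.
  by rewrite -mxevalXsubC -mxevalM -qE2.
apply: (pb_semisimple (W := mxeval T h) Tpb (t1 b bt)).
  by rewrite mxevalM mxevalXsubC mulmxBl mul_scalar_mx addrC subrK.
by apply/eqP; rewrite -mul_scalar_mx -subr_eq0 -mulmxBl Vb.
Qed.

(** In characteristic zero the multiplicity of a root drops by exactly one in the
derivative, so the other factor must vanish there. *)
Lemma root_cofactor_deriv (q r : {poly C}) a :
  q != 0 -> root q a -> q %| q^`() * r -> root r a.
Proof.
move=> q0; have [m [g]] := multiplicity_XsubC q a; rewrite q0 /= => ga ->.
case: m => [|m]; first by rewrite expr0 mulr1 (negPf ga).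
move=> _ /dvdpP[h]; rewrite derivM deriv_exp derivXsubC mul1r /=.
have Y0 : 'X - a%:P != 0 :> {poly C} by rewrite polyXsubC_eq0.
rewrite exprS -mulr_natr => E.
have : (g^`() * ('X - a%:P) + g * m.+1%:R) * r = h * g * ('X - a%:P).
  apply: (mulfI (expf_neq0 m Y0)); move: E.
  move: ('X - a%:P) (_ ^+ m) g^`() m.+1%:R => Y Z g' c E.
  transitivity (h * (g * (Y * Z))); last by ring.
  by rewrite -E; ring.
move=> /(congr1 (horner^~ a)); rewrite mulr_natr !hornerE subrr !mulr0 add0r.
move/eqP; rewrite hornerMn mulf_eq0 mulrn_eq0 /= => /orP[ga0|//].
by rewrite /root ga0 in ga.
Qed.

(** The test cocycle q_bd(T) is invertible on the generalized eigenspaces of the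
interior eigenvalues, whereas a commutator T L - L T that commutes with T is
nilpotent. *)
Lemma ext_zero_minpoly n (T : 'M[C]_n.+1) : polynomially_bounded T ->
  (forall X, polynomially_bounded (block_mx T X 0 T) ->
    exists L, X = T *m L - L *m T) ->
  exists t : seq C, [/\ {in t, forall b, cmod b = 1}, uniq t &
    mxminpoly T = \prod_(b <- t) ('X - b%:P)].
Proof.
move=> Tpb ext0; have [s [t [s1 t1 ut]]] := pb_mxminpoly_split Tpb.
set qs := \prod_(a <- s) _; set qt := \prod_(b <- t) _ => qE.
have q0 : mxeval T (mxminpoly T) = 0 by rewrite mxevalE mx_root_minpoly.
pose X := mxeval T qt.
have TX : T *m X = X *m T.
  by apply/esym/mxeval_intertwine.
(* annihilated by q_int^2 * q_bd: only the interior multiplicities double *)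
have Xpb : polynomially_bounded (block_mx T X 0 T).
  apply: (@pb_of_annihilator _ _ _ (s ++ s) t) => //.
    by move=> a; rewrite mem_cat orbb => /s1.
  rewrite big_cat /= -/qs -/qt -mulrA -qE mxeval_jordan_block//.
  have -> : mxeval T (qs * mxminpoly T) = 0 by rewrite mxevalM q0 mulmx0.
  rewrite -mxevalM.
  have -> : (qs * mxminpoly T)^`() * qt =
      mxminpoly T * (qs^`() * qt *+ 2 + qs * qt^`()).
    by rewrite qE !derivM; ring.
  by rewrite mxevalM q0 mul0mx block_mx0.
have [L XL] := ext0 X Xpb.
have := mxeval_commutator (mxminpoly T) TX XL.
rewrite q0 mul0mx mulmx0 subrr -mxevalM mxevalE => /mxminpoly_min q_dvd.
exists t; split=> //; rewrite qE.
case: s s1 @qs qE => [|a s] s1 qs qE; first by rewrite /qs big_nil mul1r.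
have /(_ a) := root_cofactor_deriv (monic_neq0 (mxminpoly_monic T)) _ q_dvd.
rewrite qE rootM root_prod_XsubC mem_head => /(_ isT).
rewrite root_prod_XsubC => /t1 a1.
by have := s1 a; rewrite mem_head a1 ltxx => /(_ isT).
Qed.

Lemma ext_zero_similar_to_unitary n (T : 'M[C]_n) : polynomially_bounded T ->
  (forall X, polynomially_bounded (block_mx T X 0 T) ->
    exists L, X = T *m L - L *m T) ->
  similar_to_unitary T.
Proof.
case: n T => [|n] T Tpb ext0.
  (* all matrices of size 0 are equal *)
  exists 1%:M; first by apply/unitarymxP; rewrite [LHS]flatmx0 [RHS]flatmx0.
  exists 1%:M; first exact: unitmx1.
  by apply/(mxpoly.simmxP (unitmx1 _ _)); rewrite [LHS]flatmx0 [RHS]flatmx0.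
have [t [t1 ut qE]] := ext_zero_minpoly Tpb ext0.
have [|P Pu /mxpoly.diagonalizable_forPex[d /(mxpoly.simmxP Pu) PT]] :=
  (mxpoly.diagonalizableP T).2.
  by exists t; rewrite ?qE.
exists (diag_mx d); last by exists P => //; apply/(mxpoly.simmxP Pu).
apply/diag_unitaryP => i; apply: t1; rewrite -root_prod_XsubC -qE.
have := mxeval_intertwine (mxminpoly T) (esym PT).
rewrite [mxeval T _]mxevalE mx_root_minpoly mulmx0 => /(congr1 (mulmx^~ (invmx P))).
rewrite mulmxK// mul0mx mxevalE horner_mx_diag => /matrixP/(_ i i).
by rewrite !mxE eqxx mulr1n => /eqP.
Qed.

End Extensions.

Theorem lemma4p3 (R : realType) (n : nat) (T : 'M[R[i]]_n)
    (hT : hilbert_module T) :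
  Ext1_zero T T <-> similar_to_unitary T.
Proof.
rewrite (Ext1_zeroP hT); split; first exact: ext_zero_similar_to_unitary.
by move=> Tu X; apply: unitary_ext_zero.
Qed.
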